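(* Let $p\neq0$ and let $S=\Sigma^2(p)=\{(x,y,z): z=\frac p2-\frac1{2p}(x^2-y^2)\}$ be the sphere of parabolic type in the pseudo-isotropic space $\mathbb{I}_{\mathrm p}^3$ centered at the origin. The relative geodesics of $S$ are obtained by intersecting $S$ with planes passing through the origin: every (regular) relative geodesic of $S$ is contained in the intersection of $S$ with a plane through the origin, and, for any plane $\Pi$ through the origin (isotropic or not), each connected component of $S\cap\Pi$ with the lightlike points of $S$ removed admits a regular parameterization as a relative geodesic.
   Context: The pseudo-isotropic space $\mathbb{I}_{\mathrm p}^3$ is $\mathbb{R}^3$ with the degenerate inner product $u^1v^1-u^2v^2$. A plane is isotropic if it contains a line parallel to the $z$-axis; a smooth surface is admissible if none of its tangent planes is isotropic. For a local parameterization $\mathbf{x}(u^1,u^2)$ of an admissible surface write $\mathbf{x}_i=\partial\mathbf{x}/\partial u^i=(x_i^1,x_i^2,x_i^3)$ and $X_{ij}=x_1^ix_2^j-x_1^jx_2^i$ (so $X_{12}\ne0$). The Gauss map is $$\xi^{\mathrm p}=\left(\frac{X_{23}}{X_{12}},\ \frac{X_{13}}{X_{12}},\ \frac12\left\{1-\left[\left(\frac{X_{23}}{X_{12}}\right)^2-\left(\frac{X_{13}}{X_{12}}\right)^2\right]\right\}\right).$$ A point of the surface is a lightlike point if $(X_{23})^2-(X_{13})^2+(X_{12})^2=0$ there. Away from lightlike points $\{\mathbf{x}_1,\mathbf{x}_2,\xi^{\mathrm p}\}$ is a basis of $\mathbb{R}^3$. A curve $\gamma:I\to S$ is a relative geodesic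 ($r$-geodesic) if, for every $t\in I$, the acceleration vector $\gamma''(t)\in\mathbb{R}^3$ is parallel to (a real multiple, possibly zero, of) $\xi^{\mathrm p}$ at $\gamma(t)$. A curve is regular if $\gamma'$ never vanishes. *)

(* Defs.v *)
From HB Require Import structures.
From mathcomp Require Import all_boot all_order all_algebra.
From mathcomp Require Import all_classical all_reals all_analysis.

Set Implicit Arguments.
Unset Strict Implicit.
Unset Printing Implicit Defensive.

Import Order.TTheory GRing.Theory Num.Theory.
Import numFieldNormedType.Exports.

Local Open Scope classical_set_scope.
Local Open Scope ring_scope.

(** Points and vectors of R^3 are row vectors [q : 'rV[R]_3], with coordinates
    [x = q 0 0], [y = q 0 1], [z = q 0 2]; parameters (u^1, u^2) are
    row vectors [u : 'rV[R]_2].  All indices start at 0, so the X_{ij} of the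
    literature is [minor x u (i-1) (j-1)] below.  The topology on R^3 is the
    usual one; only the metric is degenerate. *)

Definition vec3 (R : realType) (a b c : R) : 'rV[R]_3 :=
  \row_(j < 3) [:: a; b; c]`_j.

Section Patches.
Variable R : realType.
Implicit Types (x : 'rV[R]_2 -> 'rV[R]_3) (U W : set 'rV[R]_2)
  (S : set 'rV[R]_3) (u : 'rV[R]_2) (q v : 'rV[R]_3).

Definition partial (i : 'I_2) x : 'rV[R]_2 -> 'rV[R]_3 :=
  fun u => 'D_(delta_mx 0 i) x u.

(** C^infinity on the open set [U]: every iterated partial derivative is
    (Frechet) differentiable at every point of [U]. *)
Definition smooth_patch U x : Prop :=
  forall (s : seq 'I_2) u, U u -> differentiable (foldr partial x s) u.

(** Local parameterization of [S]: a smooth immersion of an open set, which is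
    a homeomorphism onto a relatively open subset of [S].  The openness clause
    gives both the relative openness of the image (take [W = U]) and the
    continuity of the inverse. *)
Definition local_parameterization S U x : Prop :=
  [/\ open U, smooth_patch U x,
      (forall u, U u -> row_free (\matrix_(i < 2) partial i x u)),
      (x @` U `<=` S /\ set_inj U x) &
      (forall W, open W -> W `<=` U ->
         exists2 V : set 'rV[R]_3, open V & x @` W = S `&` V)].

Definition minor x u (i j : 'I_3) : R :=
  partial 0 x u 0 i * partial 1 x u 0 j - partial 0 x u 0 j * partial 1 x u 0 i.

(** For an admissible surface [minor x u 0 1] never vanishes, so that the
    quotients are genuine. *)
Definition gauss_map x u : 'rV[R]_3 :=
  let a := minor x u 1 2 / minor x u 0 1 in
  let b := minor x u 0 2 / minor x u 0 1 in
  vec3 a b (2^-1 * (1 - (a ^+ 2 - b ^+ 2))).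

(** The Gauss map of a surface as a relation: [v] is the value at the point [q]
    of [S].  It does not depend on the local parameterization, since all the
    minors get multiplied by the same Jacobian under reparameterization. *)
Definition gauss_vector S q v : Prop :=
  exists U x u,
    [/\ local_parameterization S U x, U u, x u = q & v = gauss_map x u].

Definition lightlike S : set 'rV[R]_3 :=
  [set q | exists U x u,
    [/\ local_parameterization S U x, U u, x u = q &
        minor x u 1 2 ^+ 2 - minor x u 0 2 ^+ 2 + minor x u 0 1 ^+ 2 = 0]].

End Patches.

Section Curves.
Variable R : realType.
Implicit Types (I : set R) (g : R -> 'rV[R]_3) (S : set 'rV[R]_3).

(** Smooth curve in [S] defined on the (possibly unbounded) open interval
    [I]. *)
Definition smooth_curve S I g : Prop :=
  [/\ open I, is_interval I,
      (forall n t, I t -> derivable (derive1n n g) t 1) &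
      g @` I `<=` S].

Definition regular_curve I g : Prop :=
  forall t, I t -> derive1n 1 g t != 0.

Definition relative_geodesic S I g : Prop :=
  smooth_curve S I g /\
  forall t, I t -> exists v,
    gauss_vector S (g t) v /\ exists k : R, derive1n 2 g t = k *: v.

End Curves.

Definition parabolic_sphere (R : realType) (p : R) : set 'rV[R]_3 :=
  [set q | q 0 2 = p / 2 - (2 * p)^-1 * (q 0 0 ^+ 2 - q 0 1 ^+ 2)].

(** The plane through the origin with equation n_0 x + n_1 y + n_2 z = 0, for
    [n != 0]; it is isotropic exactly when n_2 = 0. *)
Definition plane0 (R : realType) (n : 'rV[R]_3) : set 'rV[R]_3 :=
  [set q | \sum_(i < 3) n 0 i * q 0 i = 0].

(* Main.v *)
Require Import Defs.
From HB Require Import structures.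
From mathcomp Require Import all_boot all_order all_algebra.
From mathcomp Require Import all_classical all_reals all_analysis.
From mathcomp Require Import ring lra.

Set Implicit Arguments.
Unset Strict Implicit.
Unset Printing Implicit Defensive.

Import Order.TTheory GRing.Theory Num.Theory.
Import numFieldNormedType.Exports.
Local Open Scope classical_set_scope.
Local Open Scope ring_scope.

(** Write [S] for the sphere of parabolic type.  Its Gauss map at the point [q]
    is [q / p], whatever the parameterization ([gauss_vector_sphere]): the
    minors of the tangent vectors are in the ratio x : y : p.  Hence relative
    geodesics are the curves [g] on [S] with [g''] parallel to [g], that is,
    motions in a central force field, and they are governed by the areal
    velocity [wedge g g'], whose derivative is [wedge g g''].

    If [g] is a regular relative geodesic then [wedge g g'] is constant.  If it
    is nonzero, it is the normal of a plane through the origin containing [g].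
    It cannot vanish: [g' = c g] with [c != 0] forces [z = p] by the equation of
    [S] differentiated once, and then [c = 0] by the same equation
    differentiated twice ([radial_not_geodesic]).

    Conversely, let [Pi] be a plane through the origin.  It suffices to
    parameterize each component of the regular part of [S `&` Pi] at constant
    nonzero areal velocity: then [wedge g g''] vanishes.  The section has a
    rational parameterization [c = P / D], whose areal velocity is [F / D^2] times
    a constant bivector; the lightlike points on it are the zeros of [F].
    Between two of those, a primitive [w] of [F / D^2] is a strictly monotone
    change of parameter, and [c \o w^-1] moves at constant areal velocity.  All
    its derivatives are rational functions of [w^-1], so it is smooth
    ([rational_arc_reparam]).  The image of a component of the parameter domain
    is a component of the regular part because the parameter is the restriction
    of an affine function on R^3 ([component_relative_geodesic]).

    There are two shapes of section.  On an isotropic plane, z is a polynomial of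
    degree at most 2 in a linear coordinate ([isotropic_section]).  On any other
    plane z = lam * a + mu * b, where a = x + y and b = x - y are null
    coordinates, the equation of [S] becomes (a + 2 p mu) (b + 2 p lam) = K, and
    the first factor is the parameter ([transversal_section]).  For [K = 0] this
    hyperbola splits into two lines, one of which escapes the parameter; it is
    reached by exchanging a and b, and the two lines are disconnected from each
    other because they cross at a lightlike point. *)

(** * Coordinates and the areal bivector *)

Lemma vec3_0 (R : realType) (a b c : R) : vec3 a b c 0 0 = a.
Proof. by rewrite mxE. Qed.
Lemma vec3_1 (R : realType) (a b c : R) : vec3 a b c 0 1 = b.
Proof. by rewrite mxE. Qed.
Lemma vec3_2 (R : realType) (a b c : R) : vec3 a b c 0 2 = c.
Proof. by rewrite mxE. Qed.
Definition vec3E := (vec3_0, vec3_1, vec3_2).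

Lemma ord3P (Q : 'I_3 -> Prop) : Q 0 -> Q 1 -> Q 2 -> forall i, Q i.
Proof.
move=> Q0 Q1 Q2 [[|[|[|i]]] hi] //; [move: Q0|move: Q1|move: Q2];
  by congr Q; apply/val_inj.
Qed.

Lemma ord2P (Q : 'I_2 -> Prop) : Q 0 -> Q 1 -> forall i, Q i.
Proof.
move=> Q0 Q1 [[|[|i]] hi] //; [move: Q0|move: Q1];
  by congr Q; apply/val_inj.
Qed.

Lemma rV3_eq (R : realType) (u v : 'rV[R]_3) :
  u 0 0 = v 0 0 -> u 0 1 = v 0 1 -> u 0 2 = v 0 2 -> u = v.
Proof. by move=> h0 h1 h2; apply/rowP; exact: ord3P. Qed.

(** The coordinates of the cross product of [u] and [v], as an antisymmetric
    array. *)
Definition wedge (R : realType) (u v : 'rV[R]_3) (i j : 'I_3) : R :=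
  u 0 i * v 0 j - u 0 j * v 0 i.

Lemma wedge0_parallel (R : realType) (u v : 'rV[R]_3) :
  u != 0 -> (forall i j, wedge u v i j = 0) -> exists k, v = k *: u.
Proof.
move=> u0 uv; have [i ui] : exists i, u 0 i != 0.
  apply/existsP; apply: contra_neqT u0; rewrite negb_exists => /forallP h.
  by apply/rowP => i; rewrite mxE; apply/eqP; move: (h i); rewrite negbK.
exists (v 0 i / u 0 i); apply/rowP => j; rewrite !mxE.
have := uv i j; rewrite /wedge => /subr0_eq e.
by apply: (mulfI ui); rewrite e; field.
Qed.

(** * Differentiation of curves *)

Section Curves.
Variable R : realType.
Implicit Types (f : R -> R) (I : set R) (g : R -> 'rV[R]_3) (t : R).

Lemma is_derive_coord g t j :
  derivable g t 1 -> is_derive t 1 (fun s => g s 0 j) (derive1 g t 0 j).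
Proof.
move=> dg; apply: DeriveDef; first by move/derivable_mxP: dg; exact.
by rewrite derive1E derive_mx // mxE.
Qed.

Lemma is_derive_row g (l : 'rV[R]_3) t :
  (forall j, is_derive t 1 (fun s => g s 0 j) (l 0 j)) -> is_derive t 1 g l.
Proof.
move=> dg; have gd : derivable g t 1.
  by apply/derivable_mxP => i j; rewrite (ord1 i); have [] := dg j.
apply: DeriveDef => //; rewrite derive_mx //; apply/matrixP => i j.
by rewrite mxE (ord1 i); have [] := dg j.
Qed.

Lemma derive_open_eq I f1 f2 t (l1 l2 : R) : open I -> I t ->
  (forall s, I s -> f1 s = f2 s) ->
  is_derive t 1 f1 l1 -> is_derive t 1 f2 l2 -> l1 = l2.
Proof.
move=> oI It f12 [_ <-] [_ <-]; apply: near_eq_derive.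
by near do apply: f12; exact: open_nbhs_nbhs.
Unshelve. all: by end_near. Qed.

Lemma derive0_interval_cst I f : open I -> is_interval I ->
  (forall t, I t -> is_derive t 1 f 0) -> forall a b, I a -> I b -> f a = f b.
Proof.
move=> oI iI df a b; wlog ab : a b / a < b => [H Ia Ib|].
  by have [/H->//|/H<-//|->] := ltgtP a b.
move=> Ia Ib; have Iab x : a <= x <= b -> I x by exact: iI.
have dI x : x \in `]a, b[ -> is_derive x 1 f ((fun=> 0) x).
  by rewrite in_itv /= => /andP[ax xb]; apply/df/Iab; rewrite !ltW.
have [] := @MVT R f (fun=> 0) a b ab dI.
  apply: derivable_within_continuous => x; rewrite in_itv /= => xab.
  by have [] := df x (Iab _ xab).
by move=> c _ /eqP; rewrite mul0r subr_eq0 => /eqP.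
Qed.

Lemma derive_neq0_interval_inj I f (df : R -> R) : is_interval I ->
  (forall t, I t -> is_derive t 1 f (df t)) -> (forall t, I t -> df t != 0) ->
  {in I &, injective f}.
Proof.
move=> iI dfE df0 a b; rewrite !inE.
wlog ab : a b / a < b => [H Ia Ib fab|Ia Ib fab].
  have [ab|ba|//] := ltgtP a b; first exact: H.
  by apply/esym/H.
exfalso; have Iab x : a <= x <= b -> I x by exact: iI.
have Ioo x : x \in `]a, b[ -> I x.
  by rewrite in_itv /= => /andP[ax xb]; apply: Iab; rewrite !ltW.
have [] := @Rolle R f a b ab _ _ fab.
- by move=> x /Ioo Ix; have [] := dfE x Ix.
- apply: derivable_within_continuous => x; rewrite in_itv /= => xab.
  by have [] := dfE x (Iab _ xab).
- move=> c /Ioo Ic [_ dc]; have [_ dc'] := dfE c Ic.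
  by move: (df0 c Ic); rewrite -dc' dc eqxx.
Qed.

(** The term [wedge g' g'] of the product rule cancels. *)
Lemma is_derive_wedge g t i j :
  derivable g t 1 -> derivable (derive1 g) t 1 ->
  is_derive t 1 (fun s => wedge (g s) (derive1 g s) i j)
    (wedge (g t) (derive1n 2 g t) i j).
Proof.
move=> dg ddg; have gi k := is_derive_coord k dg.
have g'i k := is_derive_coord k ddg.
apply: is_derive_eq; rewrite /wedge derive1nS derive1n1 !/GRing.scale /=.
by ring.
Qed.

End Curves.

(** * The Gauss map of the sphere *)

(** If all minors vanish, then [(M 1 k, - M 0 k)] is a linear relation between
    the rows for every [k]; so the second row vanishes,
    which is again a linear relation. *)
Lemma row_free_minor (R : fieldType) (M : 'M[R]_(2, 3)) : row_free M ->
  exists j k, M 0 j * M 1 k - M 0 k * M 1 j != 0.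
Proof.
move=> free; apply: contrapT => /forallNP m0.
have M1 k : M 1 k = 0.
  pose v : 'rV[R]_2 := \row_i [:: M 1 k; - M 0 k]`_i.
  have : v *m M == 0.
    apply/eqP/rowP => j; rewrite !mxE !big_ord_recl big_ord0 !mxE /=.
    have -> : lift ord0 ord0 = 1 :> 'I_2 by apply/val_inj.
    have -> : ord0 = 0 :> 'I_2 by apply/val_inj.
    move/forallNP/(_ k)/negP: (m0 j); rewrite negbK => /eqP e; rewrite -[RHS]e; ring.
  by rewrite mulmx_free_eq0 // => /eqP/rowP/(_ 0); rewrite !mxE.
have : (delta_mx 0 1 : 'rV[R]_2) *m M == 0.
  by apply/eqP/rowP => j; rewrite -rowE !mxE M1.
rewrite mulmx_free_eq0 // => /eqP/rowP/(_ 1); rewrite !mxE eqxx /= => /eqP.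
by rewrite oner_eq0.
Qed.

Section Sphere.
Variables (R : realType) (p : R).
Hypothesis p0 : p != 0.
Implicit Types (x : 'rV[R]_2 -> 'rV[R]_3) (U : set 'rV[R]_2) (u : 'rV[R]_2)
  (q : 'rV[R]_3).

Local Notation S := (parabolic_sphere p).

Lemma sphereP q :
  S q <-> 2 * p * q 0 2 = p ^+ 2 - q 0 0 ^+ 2 + q 0 1 ^+ 2.
Proof.
rewrite /parabolic_sphere /=; split => [->|h]; first by field.
by apply: (@mulfI _ (2 * p)); [rewrite mulf_neq0 ?pnatr_eq0|rewrite h; field].
Qed.

Lemma sphere_neq0 q : S q -> q != 0.
Proof.
move=> /sphereP + ; apply: contra_eq_neq => ->; rewrite !mxE.
by rewrite mulr0 expr0n subr0 addr0 eq_sym expf_neq0.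
Qed.

Lemma partial_coord U x u i j : smooth_patch U x -> U u ->
  is_derive u (delta_mx 0 i) (fun v => x v 0 j) (partial i x u 0 j).
Proof.
move=> /(_ [::] u) /= sx /sx /(@diff_derivable _ _ _ _ _ (delta_mx 0 i)) dx.
apply: DeriveDef; first by move/derivable_mxP: dx; exact.
by rewrite /partial derive_mx // mxE.
Qed.

(** The equation of the sphere differentiated along a coordinate line. *)
Lemma sphere_tangent U x u i : local_parameterization S U x -> U u ->
  p * partial i x u 0 2
  = x u 0 1 * partial i x u 0 1 - x u 0 0 * partial i x u 0 0.
Proof.
move=> [oU sx _ [xS _] _] Uu; have d j := partial_coord i j sx Uu.
pose f v := 2 * p * x v 0 2 + x v 0 0 ^+ 2 - x v 0 1 ^+ 2.
have df : is_derive u (delta_mx 0 i) f (2 * p * partial i x u 0 2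
   + 2 * x u 0 0 * partial i x u 0 0 - 2 * x u 0 1 * partial i x u 0 1).
  by rewrite /f; apply: is_derive_eq; rewrite !/GRing.scale /= ?expr1; ring.
have f0 : 'D_(delta_mx 0 i) f u = 0.
  rewrite -(derive_cst (p ^+ 2) u (delta_mx 0 i)); apply: near_eq_derive.
  near=> v; have /sphereP Sv : S (x v).
    by apply: xS; exists v => //; near: v; exact: open_nbhs_nbhs.
  by rewrite /f Sv /cst; ring.
case: df => _; rewrite f0 => /esym e.
by apply: (@mulfI _ 2); rewrite ?pnatr_eq0 //; apply/subr0_eq; rewrite -e; ring.
Unshelve. all: by end_near. Qed.

Let tangent_minors (a b : 'I_3 -> R) (X Y : R) :
  p * a 2 = Y * a 1 - X * a 0 -> p * b 2 = Y * b 1 - X * b 0 ->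
  p * (a 1 * b 2 - a 2 * b 1) = X * (a 0 * b 1 - a 1 * b 0) /\
  p * (a 0 * b 2 - a 2 * b 0) = Y * (a 0 * b 1 - a 1 * b 0).
Proof.
move: (a 0) (a 1) (a 2) (b 0) (b 1) (b 2) => a0 a1 a2 b0 b1 b2 ta tb.
have <- : a1 * (p * b2) - (p * a2) * b1 = p * (a1 * b2 - a2 * b1) by ring.
have <- : a0 * (p * b2) - (p * a2) * b0 = p * (a0 * b2 - a2 * b0) by ring.
by rewrite ta tb; split; ring.
Qed.

(** The tangent plane at [(x, y, z)] is the graph of the linear form
    [(- x du + y dv) / p], which determines the ratios of the minors; if the
    first one vanished, so would the others. *)
Lemma sphere_minors U x u : local_parameterization S U x -> U u ->
  [/\ p * minor x u 1 2 = x u 0 0 * minor x u 0 1,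
      p * minor x u 0 2 = x u 0 1 * minor x u 0 1 & minor x u 0 1 != 0].
Proof.
move=> lx Uu; have t0 := sphere_tangent 0 lx Uu.
have t1 := sphere_tangent 1 lx Uu.
have [m12 m02] : p * minor x u 1 2 = x u 0 0 * minor x u 0 1 /\
    p * minor x u 0 2 = x u 0 1 * minor x u 0 1.
  exact: (tangent_minors t0 t1).
split => //; apply/eqP => m01; move: m12 m02; rewrite m01 !mulr0.
move=> /eqP; rewrite mulf_eq0 (negbTE p0) /= => /eqP m12.
move=> /eqP; rewrite mulf_eq0 (negbTE p0) /= => /eqP m02.
have ms j k : minor x u k j = - minor x u j k by rewrite /minor opprB.
have mm j : minor x u j j = 0 by rewrite /minor subrr.
have [_ _ /(_ u Uu) /row_free_minor [j [k +]] _ _] := lx.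
rewrite !mxE => /eqP; apply; rewrite -[LHS]/(minor x u j k).
move: j k; apply: ord3P; apply: ord3P; rewrite ?mm //;
  by rewrite ms ?m01 ?m02 ?m12 oppr0.
Qed.

Lemma gauss_map_sphere U x u : local_parameterization S U x -> U u ->
  gauss_map x u = p^-1 *: x u.
Proof.
move=> lx Uu; have [m12 m02 m01] := sphere_minors lx Uu.
have Sx : S (x u) by have [_ _ _ [h _] _] := lx; apply: h; exists u.
have e12 : minor x u 1 2 / minor x u 0 1 = x u 0 0 / p.
  by apply: (mulfI p0); rewrite mulrA m12; field; rewrite m01 p0.
have e02 : minor x u 0 2 / minor x u 0 1 = x u 0 1 / p.
  by apply: (mulfI p0); rewrite mulrA m02; field; rewrite m01 p0.
rewrite /gauss_map e12 e02.
apply: rV3_eq; rewrite vec3E mxE; [exact: mulrC|exact: mulrC|].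
by rewrite Sx; field.
Qed.

(** Quadratic maps form a class closed under partial derivatives that contains
    the graph parameterization; this gives its smoothness. *)
Let quad (a b c d e : 'rV[R]_3) : 'rV[R]_2 -> 'rV[R]_3 := fun u =>
  u 0 0 ^+ 2 *: a + u 0 1 ^+ 2 *: b + u 0 0 *: c + u 0 1 *: d + e.

Let quad_diff a b c d e u : differentiable (quad a b c d e) u.
Proof.
have dc i := @differentiable_coord R 1 2 u 0 i.
have d2 i : differentiable (fun v : 'rV[R]_2 => v 0 i ^+ 2) u.
  exact: (@differentiableX _ _ (fun v : 'rV[R]_2 => v 0 i) 1 u (dc i)).
apply: differentiableD; last exact: differentiable_cst.
by do 3?[apply: differentiableD]; apply: differentiableZl.
Qed.

Let is_derive_coord2 (u v : 'rV[R]_2) i :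
  is_derive u v (fun w : 'rV[R]_2 => w 0 i) (v 0 i).
Proof.
have d : derivable (@idfun 'rV[R]_2) u v by exact: derivable_id.
apply: DeriveDef; first by move/derivable_mxP: d; exact.
by have := derive_mx d; rewrite derive_id => /matrixP/(_ 0 i); rewrite mxE.
Qed.

Let quad_partial i a b c d e : partial i (quad a b c d e) =
  if i == 0 then quad 0 0 (2 *: a) 0 c else quad 0 0 0 (2 *: b) d.
Proof.
apply/funext => u; rewrite /partial derive_mx; last first.
  exact/diff_derivable/quad_diff.
apply/rowP => j; rewrite mxE /quad.
under [X in 'D__ X _]eq_fun do rewrite !mxE.
have d0 := is_derive_coord2 u (delta_mx 0 i) 0.
have d1 := is_derive_coord2 u (delta_mx 0 i) 1.
have df : is_derive u (delta_mx 0 i) (fun w : 'rV[R]_2 =>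
    w 0 0 ^+ 2 * a 0 j + w 0 1 ^+ 2 * b 0 j + w 0 0 * c 0 j + w 0 1 * d 0 j
    + e 0 j) ((2 * u 0 0 * a 0 j + c 0 j) * (delta_mx 0 i : 'rV[R]_2) 0 0
     + (2 * u 0 1 * b 0 j + d 0 j) * (delta_mx 0 i : 'rV[R]_2) 0 1).
  by apply: is_derive_eq; rewrite !/GRing.scale /= ?expr1; ring.
case: df => _ ->; move: i {d0 d1}; apply: ord2P => /=; rewrite !mxE /=; ring.
Qed.

Definition sphere_graph u : 'rV[R]_3 :=
  vec3 (u 0 0) (u 0 1) (p / 2 - (2 * p)^-1 * (u 0 0 ^+ 2 - u 0 1 ^+ 2)).

Let sphere_graph_in u : S (sphere_graph u).
Proof. by rewrite /parabolic_sphere /sphere_graph /mkset !vec3E. Qed.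

Let sphere_graphE : sphere_graph =
  quad (vec3 0 0 (- (2 * p)^-1)) (vec3 0 0 (2 * p)^-1) (vec3 1 0 0)
    (vec3 0 1 0) (vec3 0 0 (p / 2)).
Proof.
apply/funext => u; apply: rV3_eq; rewrite /sphere_graph /quad vec3E;
  rewrite ![in RHS]mxE /=; ring.
Qed.

Lemma sphere_graph_parameterization :
  local_parameterization S setT sphere_graph.
Proof.
split; [exact: openT| | | |].
- move=> s u _; rewrite sphere_graphE.
  suff [a [b [c [d [e ->]]]]] : exists a b c d e,
      foldr (@partial R) (quad (vec3 0 0 (- (2 * p)^-1)) (vec3 0 0 (2 * p)^-1)
        (vec3 1 0 0) (vec3 0 1 0) (vec3 0 0 (p / 2))) s = quad a b c d e.
    exact: quad_diff.
  elim: s => [|i s [a [b [c [d [e ih]]]]]] /=; first by do 5!eexists.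
  by rewrite ih quad_partial; case: ifP => _; do 5!eexists.
- move=> u _; apply/row_freeP.
  exists (\matrix_(i < 3, j < 2) (val i == val j)%:R); apply/matrixP => i j.
  rewrite mxE !big_ord_recl big_ord0 !mxE sphere_graphE quad_partial /quad.
  move: i j; apply: ord2P; apply: ord2P; rewrite /= !mxE /=; ring.
- split => [q [u _ <-]|u v _ _ uv]; first exact: sphere_graph_in.
  by apply/rowP; apply: ord2P; [have := congr1 (fun q => q 0 0) uv
    |have := congr1 (fun q => q 0 1) uv]; rewrite /sphere_graph !vec3E.
- move=> W oW _; exists ((@lsubmx R 1 2 1) @^-1` W).
    by apply: open_comp => // ? _; exact: continuous_lsubmx.
  have ls q : (lsubmx (q : 'M[R]_(1, 2 + 1))) = \row_i [:: q 0 0; q 0 1]`_i.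
    apply/rowP; apply: ord2P; rewrite !mxE /=; congr (q _ _); exact/val_inj.
  apply/seteqP; split => [q [u Wu <-]|q [Sq Wq]].
    split; first exact: sphere_graph_in.
    suff e : lsubmx (sphere_graph u : 'M[R]_(1, 2 + 1)) = u by move: Wu; rewrite -{1}e.
    by rewrite ls /sphere_graph !vec3E; apply/rowP; apply: ord2P; rewrite mxE.
  exists (lsubmx (q : 'M[R]_(1, 2 + 1))) => //.
  by apply: rV3_eq; rewrite ls /sphere_graph vec3E !mxE //= Sq.
Qed.

Lemma gauss_vector_sphere q v : S q -> gauss_vector S q v <-> v = p^-1 *: q.
Proof.
move=> Sq; split => [[U [x [u [lx Uu <- ->]]]]|->].
  exact: (gauss_map_sphere lx Uu).
exists setT, sphere_graph, (\row_i [:: q 0 0; q 0 1]`_i).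
have gq : sphere_graph (\row_i [:: q 0 0; q 0 1]`_i) = q.
  by apply: rV3_eq; rewrite /sphere_graph vec3E !mxE //= Sq.
split => //; first exact: sphere_graph_parameterization.
by rewrite (gauss_map_sphere sphere_graph_parameterization) // gq.
Qed.

(** By the ratios of the minors, [x^2 - y^2 + p^2] is the form that defines
    lightlike points times the nonzero factor [(p / X_12)^2]. *)
Lemma lightlike_sphere q :
  S q -> lightlike S q <-> q 0 0 ^+ 2 - q 0 1 ^+ 2 + p ^+ 2 = 0.
Proof.
move=> Sq.
have key U x u : local_parameterization S U x -> U u -> x u = q ->
    minor x u 1 2 ^+ 2 - minor x u 0 2 ^+ 2 + minor x u 0 1 ^+ 2 = 0 <->
    q 0 0 ^+ 2 - q 0 1 ^+ 2 + p ^+ 2 = 0.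
  move=> lx Uu xq; have [m12 m02 m01] := sphere_minors lx Uu.
  have e : p ^+ 2 * (minor x u 1 2 ^+ 2 - minor x u 0 2 ^+ 2 + minor x u 0 1 ^+ 2)
      = minor x u 0 1 ^+ 2 * (q 0 0 ^+ 2 - q 0 1 ^+ 2 + p ^+ 2).
    by rewrite mulrDr mulrBr -!exprMn m12 m02 xq; ring.
  split=> h; move: e; rewrite h mulr0.
    by move=> /esym/eqP; rewrite mulf_eq0 expf_eq0 (negbTE m01) andbF /= => /eqP.
  by move=> /eqP; rewrite mulf_eq0 expf_eq0 (negbTE p0) andbF /= => /eqP.
split => [[U [x [u [lx Uu xq h]]]]|h]; first exact/(key U x u).
have [U [x [u [lx Uu xq _]]]] := (gauss_vector_sphere (p^-1 *: q) Sq).2 erefl.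
by exists U, x, u; split => //; apply/(key U x u).
Qed.

End Sphere.

(** * Relative geodesics are planar *)

Section GeodesicsPlanar.
Variables (R : realType) (p : R).
Hypothesis p0 : p != 0.
Local Notation S := (parabolic_sphere p).

(** With [g' = c g] the equation of the sphere differentiated once reads
    [c p (z - p) = 0].  If [c != 0] then [z = p], and the equation differentiated
    twice becomes [c ^+ 2 * p ^+ 2 = 0]. *)
Lemma radial_not_geodesic (I : set R) (g : R -> 'rV[R]_3) t (c k : R) :
  smooth_curve S I g -> I t ->
  derive1 g t = c *: g t -> derive1n 2 g t = k *: g t -> c = 0.
Proof.
move=> [oI _ sg gS] It g'E g''E.
have d j s (Is : I s) := is_derive_coord j (sg 0 s Is).
have d' j := is_derive_coord j (sg 1 t It).
have Sg s (Is : I s) : S (g s) by apply: gS; exists s.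
have e1 s : I s -> p * derive1 g s 0 2
    = g s 0 1 * derive1 g s 0 1 - g s 0 0 * derive1 g s 0 0.
  move=> Is; have [[d0 d1] d2] := (d 0 s Is, d 1 s Is, d 2 s Is).
  apply: (@mulfI _ 2); rewrite ?pnatr_eq0 //.
  apply: (@derive_open_eq _ I (fun s => 2 * p * g s 0 2)
    (fun s => p ^+ 2 - g s 0 0 ^+ 2 + g s 0 1 ^+ 2) s) => //.
  - by move=> r Ir; apply/(sphereP p0)/Sg.
  - by apply: is_derive_eq; rewrite /GRing.scale /=; ring.
  - by apply: is_derive_eq; rewrite /GRing.scale /= ?expr1; ring.
have e2 : p * derive1n 2 g t 0 2
    = derive1 g t 0 1 ^+ 2 + g t 0 1 * derive1n 2 g t 0 1
      - derive1 g t 0 0 ^+ 2 - g t 0 0 * derive1n 2 g t 0 0.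
  have [[d0 d1] d2] := (d 0 t It, d 1 t It, d 2 t It).
  have [[d'0 d'1] d'2] := (d' 0, d' 1, d' 2).
  rewrite derive1n1 in d'0 d'1 d'2.
  apply: (@derive_open_eq _ I (fun s => p * derive1 g s 0 2)
    (fun s => g s 0 1 * derive1 g s 0 1 - g s 0 0 * derive1 g s 0 0) t) => //.
  apply: is_derive_eq; rewrite derive1nS derive1n1 /GRing.scale /=; ring.
have /(sphereP p0) St := Sg t It; move: (e1 t It) e2; rewrite g'E g''E !mxE.
move: (g t 0 0) (g t 0 1) (g t 0 2) St => x y z St E1 E2.
have cE : c * p * (z - p) = 0.
  transitivity (c * (2 * p * z) - c * p ^+ 2 - p * (c * z)); first by ring.
  by rewrite St E1; ring.
have [//|c0] := eqVneq c 0.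
have zp : z = p.
  by move/eqP: cE; rewrite !mulf_eq0 (negbTE c0) (negbTE p0) subr_eq0 => /eqP.
have : c ^+ 2 * p ^+ 2 = 0.
  have yx : y ^+ 2 - x ^+ 2 = p ^+ 2 by move: St; rewrite zp; lra.
  have : p * (k * z) = (c ^+ 2 + k) * (y ^+ 2 - x ^+ 2) by rewrite E2; ring.
  move=> E3; transitivity ((c ^+ 2 + k) * p ^+ 2 - k * p ^+ 2); first by ring.
  by rewrite -yx -E3 yx zp; ring.
by move/eqP; rewrite mulf_eq0 !expf_eq0 /= (negbTE c0) (negbTE p0).
Qed.

(** The Gauss map is proportional to the position vector, which never vanishes
    on the sphere; so being parallel to it is a vanishing cross product. *)
Lemma relative_geodesic_sphere I g : relative_geodesic S I g <->
  smooth_curve S I g /\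
  forall t, I t -> forall i j, wedge (g t) (derive1n 2 g t) i j = 0.
Proof.
have Sg s : smooth_curve S I g -> I s -> S (g s).
  by move=> [_ _ _ gS] Is; apply: gS; exists s.
split=> -[sg h]; split=> // t It.
  have [v [/(gauss_vector_sphere p0 _ (Sg t sg It)) -> [k ->]]] := h t It.
  by move=> i j; rewrite /wedge !mxE; ring.
have [k gE] := wedge0_parallel (sphere_neq0 p0 (Sg t sg It)) (h t It).
exists (p^-1 *: g t); split; first exact/(gauss_vector_sphere p0 _ (Sg t sg It)).
by exists (k * p); rewrite scalerA mulfK.
Qed.

(** The constant areal bivector is the normal vector of the plane. *)
Lemma relative_geodesic_planar I g :
  relative_geodesic S I g -> regular_curve I g ->
  exists2 n : 'rV[R]_3, n != 0 & g @` I `<=` S `&` plane0 n.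
Proof.
move=> /relative_geodesic_sphere [sg wg] rg.
have [oI iI dg gS] := sg.
have [[t0 It0]|/forallNP I0] := pselect (exists t, I t); last first.
  exists (vec3 1 0 0); last by move=> ? [t It]; case: (I0 t).
  by apply/eqP => /rowP/(_ 0); rewrite vec3E mxE => /eqP; rewrite oner_eq0.
pose w t := wedge (g t) (derive1 g t).
have wE i j t : I t -> w t i j = w t0 i j.
  move=> It; apply: (derive0_interval_cst (f := fun t => w t i j) oI iI) => // s Is.
  by rewrite -(wg s Is i j); apply: is_derive_wedge; [exact: (dg 0)|exact: (dg 1)].
exists (vec3 (w t0 1 2) (w t0 2 0) (w t0 0 1)).
  apply/eqP => w0; have w0E i j : wedge (g t0) (derive1 g t0) i j = 0.
    have ws a b : w t0 b a = - w t0 a b by rewrite /w /wedge; ring.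
    have wii a : w t0 a a = 0 by rewrite /w /wedge; ring.
    have w12 : w t0 1 2 = 0 by move/rowP/(_ 0): w0; rewrite vec3E mxE.
    have w20 : w t0 2 0 = 0 by move/rowP/(_ 1): w0; rewrite vec3E mxE.
    have w01 : w t0 0 1 = 0 by move/rowP/(_ 2): w0; rewrite vec3E mxE.
    rewrite -/(w t0 i j); move: i j; apply: ord3P; apply: ord3P;
      by rewrite ?wii // ?(w12, w20, w01) // ws ?(w12, w20, w01) oppr0.
  have gt0 : g t0 != 0 by apply: (sphere_neq0 p0); apply: gS; exists t0.
  have [c g'E] := wedge0_parallel gt0 w0E.
  have [k g''E] := wedge0_parallel gt0 (wg t0 It0).
  move: (rg t0 It0); rewrite derive1n1 g'E.
  by rewrite (radial_not_geodesic sg It0 g'E g''E) scale0r eqxx.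
move=> _ [t It <-]; split; first by apply: gS; exists t.
rewrite /plane0 /mkset !big_ord_recl big_ord0.
have -> : ord0 = 0 :> 'I_3 by exact/val_inj.
have -> : lift 0 0 = 1 :> 'I_3 by exact/val_inj.
have -> : lift 0 (lift 0 0) = 2 :> 'I_3 by exact/val_inj.
rewrite !vec3E -!(wE _ _ t It) /w /wedge.
move: (derive1 g t 0) (g t 0) => a b; ring.
Qed.

End GeodesicsPlanar.

(** * Rational arcs at constant areal velocity *)

Lemma is_derive_fraction (R : realType) (N M : {poly R}) k (s : R) :
  M.[s] != 0 ->
  is_derive s 1 (fun x => N.[x] / M.[x] ^+ k)
    ((N^`() * M - k%:R *: (N * M^`())).[s] / M.[s] ^+ k.+1).
Proof.
move=> M0; have dV : is_derive s 1 (fun x => (M.[x] ^+ k)^-1)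
    (- (M.[s] ^+ k) ^- 2 *: (k%:R * M.[s] ^+ k.-1 * M^`().[s])).
  apply: (@is_deriveV _ (fun x => M.[x] ^+ k)); first by rewrite expf_neq0.
  have -> : (fun x => M.[x] ^+ k) = (horner M) ^+ k.
    by apply/funext => x; rewrite exprfctE.
  by apply: is_derive_eq; rewrite /GRing.scale.
apply: is_derive_eq; rewrite !hornerE /GRing.scale /=.
case: k {dV} => [|k] /=; first by rewrite expr0; field.
by rewrite !exprS; field; rewrite M0 expf_neq0.
Qed.

Lemma derivable_continuous_within (R : realType) (V : normedModType R)
    (J : set R) (f : R -> V) :
  (forall s, J s -> derivable f s 1) -> {within J, continuous f}.
Proof.
move=> df; apply: continuous_in_subspaceT => s; rewrite inE => Js.
exact/differentiable_continuous/derivable1_diffP/df.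
Qed.

(** The projective curve [P / D] has areal velocity [(P i P j' - P j P i') / D^2],
    since the terms in [D'] cancel.  When this is [m i j * F / D^2] with [m]
    constant, using a primitive [w] of [F / D^2] as the new parameter turns it
    into [m]. *)
Section RationalArc.
Variables (R : realType) (P : 'I_3 -> {poly R}) (D F : {poly R}) (w : R -> R).
Variables (m : 'I_3 -> 'I_3 -> R) (J : set R).
Hypothesis oJ : open J.
Hypothesis iJ : is_interval J.
Hypothesis D0 : forall s, J s -> D.[s] != 0.
Hypothesis F0 : forall s, J s -> F.[s] != 0.
Hypothesis dw : forall s, J s -> is_derive s 1 w (F.[s] / D.[s] ^+ 2).
Hypothesis wedgeP : forall s i j,
  (P i).[s] * (P j)^`().[s] - (P j).[s] * (P i)^`().[s] = m i j * F.[s].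

Definition rational_arc (s : R) : 'rV[R]_3 := \row_j ((P j).[s] / D.[s]).

Let sigma : R -> R := pinv_ (fun=> 0) J w.
Let gamma (t : R) := rational_arc (sigma t).

Let w_inj : {in J &, injective w}.
Proof.
apply: (derive_neq0_interval_inj iJ dw) => s Js.
by rewrite mulf_neq0 ?invr_eq0 ?expf_neq0 ?F0 ?D0.
Qed.

Let sigmaK s : J s -> sigma (w s) = s.
Proof. by move=> Js; apply: (@pinvKV R R (fun=> 0) J w w_inj); rewrite inE. Qed.

Let near_sigmaK s : J s -> \forall x \near s, sigma (w x) = x.
Proof.
by move=> Js; near do apply: sigmaK; exact: open_nbhs_nbhs.
Unshelve. all: by end_near. Qed.

Let near_w_cont s : J s -> \forall x \near s, {for x, continuous w}.
Proof.
move=> Js; have : \forall x \near s, J x by exact: open_nbhs_nbhs.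
apply: filterS => x Jx; apply: differentiable_continuous.
by apply/derivable1_diffP; have [] := dw Jx.
Qed.

(** The inverse is continuous at [w s], so that it stays in the open set [J]
    nearby; this makes the range of [w] open. *)
Let near_range s : J s -> \forall t \near w s, J (sigma t) /\ w (sigma t) = t.
Proof.
move=> Js.
have K := near_continuous_can_sym (near_w_cont Js) (near_sigmaK Js).
have : {for w s, continuous sigma}.
  exact: (nbhs_singleton (near_can_continuous (near_sigmaK Js) (near_w_cont Js))).
rewrite /prop_for /continuous_at sigmaK // => /(_ J (open_nbhs_nbhs _)) cs.
near=> t; split; last by near: t.
by near: t; apply: cs; split.
Unshelve. all: by end_near. Qed.

Let is_derive_sigma s : J s -> is_derive (w s) 1 sigma (D.[s] ^+ 2 / F.[s]).
Proof.
move=> Js; have -> : D.[s] ^+ 2 / F.[s] = (F.[s] / D.[s] ^+ 2)^-1.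
  by field; rewrite F0 ?D0.
apply: is_derive_inverse; [exact: near_sigmaK|exact: near_w_cont|exact: dw|].
by rewrite mulf_neq0 ?invr_eq0 ?expf_neq0 ?F0 ?D0.
Qed.

Let open_range : open (w @` J).
Proof.
rewrite openE => _ [s Js <-]; rewrite /interior.
by apply: filterS (near_range Js) => t [Jt <-]; exists (sigma t).
Qed.

Let interval_range : is_interval (w @` J).
Proof.
apply/connected_intervalP/connected_continuous_connected.
  exact/connected_intervalP.
by apply: derivable_continuous_within => s Js; have [] := dw Js.
Qed.

Lemma rational_arc_connected : connected (rational_arc @` J).
Proof.
apply: connected_continuous_connected; first exact/connected_intervalP.
apply: derivable_continuous_within => s Js; apply/derivable_mxP => i j.
under eq_fun do rewrite mxE -[D.[_]]expr1.
by have [] := is_derive_fraction (P j) 1 (D0 Js).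
Qed.

(** Since the derivative of [sigma] at [w s] is [D^2 / F], the fractions
    [N / (D F)^k] evaluated at [sigma] are closed under differentiation; [dfrac]
    is the numerator of the derivative over [(D F)^(k + 2)]. *)
Let frac (N : 'I_3 -> {poly R}) k t : 'rV[R]_3 :=
  \row_j ((N j).[sigma t] / (D * F).[sigma t] ^+ k).

Let dfrac (N : 'I_3 -> {poly R}) k j : {poly R} :=
  ((N j)^`() * (D * F) - k%:R *: (N j * (D * F)^`())) * D ^+ 3.

Let is_derive_frac N k t : (w @` J) t ->
  is_derive t 1 (frac N k) (frac (dfrac N k) k.+2 t).
Proof.
move=> [s Js <-]; apply: is_derive_row => j; rewrite [X in is_derive _ _ _ X]mxE.
under eq_fun do rewrite mxE.
have DF0 : (D * F).[sigma (w s)] != 0 by rewrite sigmaK // hornerM mulf_neq0 ?D0 ?F0.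
have ds := is_derive_sigma Js; have dN := is_derive_fraction (N j) k DF0.
apply: (is_derive_eq (is_derive1_comp dN ds)).
move: DF0; rewrite sigmaK // [dfrac _ _ _]/dfrac.
set Q := _ - _; rewrite !hornerM ?horner_exp => DF0.
rewrite !exprS; field.
by rewrite D0 // F0 // expf_neq0.
Qed.

Let derive1n_gamma n : exists N k, forall t, (w @` J) t ->
  derive1n n gamma t = frac N k t.
Proof.
elim: n => [|n [N [k ih]]].
  exists (fun j => P j * F), 1%N => t [s Js <-]; rewrite derive1n0.
  apply/rowP => j; rewrite !mxE expr1 !hornerM sigmaK //.
  by field; rewrite D0 ?F0.
exists (dfrac N k), k.+2 => t It; rewrite derive1nS derive1E.
have [_ <-] := is_derive_frac N k It; apply: near_eq_derive.
by near do apply: ih; exact: open_nbhs_nbhs.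
Unshelve. all: by end_near. Qed.

Let derivable_gamma n t : (w @` J) t -> derivable (derive1n n gamma) t 1.
Proof.
move=> It; have [N [k e]] := derive1n_gamma n.
have [+ _] := is_derive_frac N k It; apply: near_eq_derivable.
near=> r; apply/esym/e; near: r; exact: open_nbhs_nbhs.
Unshelve. all: by end_near. Qed.

(** The new parameter makes the areal velocity constant. *)
Let wedge_gamma i j t : (w @` J) t -> wedge (gamma t) (derive1 gamma t) i j = m i j.
Proof.
move=> It; have d k := is_derive_coord k (@derivable_gamma 0%N _ It).
rewrite derive1n0 in d; case: It d => s Js <- d.
have e k : derive1 gamma (w s) 0 k
   = ((P k)^`().[s] * D.[s] - (P k).[s] * D^`().[s]) / F.[s].
  have [_ <-] := d k.
  under [X in 'D__ X _]eq_fun do rewrite mxE -[D.[_]]expr1.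
  have Ds : D.[sigma (w s)] != 0 by rewrite sigmaK ?D0.
  have [_ ->] := is_derive1_comp (is_derive_fraction (P k) 1 Ds)
    (is_derive_sigma Js).
  rewrite sigmaK // hornerD hornerN hornerZ !hornerM; field.
  by rewrite D0 ?F0.
rewrite /wedge !e !mxE sigmaK //.
apply: (mulIf (F0 Js)); rewrite -wedgeP.
by field; rewrite D0 ?F0.
Qed.

Lemma rational_arc_reparam S : (exists i j, m i j != 0) ->
  {in J &, injective rational_arc} -> rational_arc @` J `<=` S ->
  exists I g, [/\ smooth_curve S I g, regular_curve I g,
    (forall t, I t -> forall i j, wedge (g t) (derive1n 2 g t) i j = 0) &
    set_bij I (rational_arc @` J) g].
Proof.
move=> [i0 [j0 mij]] injc JS; exists (w @` J), gamma; split.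
- split; [exact: open_range|exact: interval_range|exact: derivable_gamma|].
  by move=> _ [_ [s Js <-] <-]; apply: JS; exists s; rewrite // /gamma sigmaK.
- move=> t It; apply: contra_neq mij => g'0.
  by rewrite -(wedge_gamma i0 j0 It) -derive1n1 g'0 /wedge !mxE !mulr0 subrr.
- move=> t It i j; apply: (@derive_open_eq _ (w @` J)
    (fun s => wedge (gamma s) (derive1 gamma s) i j) (fun=> m i j) t) => //.
    by move=> s Is; exact: wedge_gamma.
  apply: is_derive_wedge; first exact: (@derivable_gamma 0%N _ It).
  exact: (@derivable_gamma 1%N _ It).
- split.
  + by move=> _ [s Js <-]; exists s; rewrite // /gamma sigmaK.
  + move=> t1 t2; rewrite !inE => -[s1 Js1 <-] [s2 Js2 <-].
    by rewrite /gamma !sigmaK // => /injc ->; rewrite ?inE.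
  + by move=> _ [s Js <-]; exists (w s); rewrite /gamma ?sigmaK //; exists s.
Qed.

End RationalArc.

(** * From arcs to connected components *)

Lemma open_component_real (R : realType) (G : set R) x :
  open G -> open (connected_component G x).
Proof.
rewrite !openE => oG s Gs.
have /nbhs_ballP [e e0 eG] := oG s (connected_component_sub Gs).
apply/nbhs_ballP; exists e => //.
rewrite (same_connected_component Gs); apply: connected_component_max => //.
  exact: ballxx.
by rewrite ball_itv; apply/connected_intervalP/interval_is_interval.
Qed.

(** The plane of the section is spanned by [u] and [v], in which basis the curve
    is [(Pa / D, Pb / D)].  The function [l] on the whole space recovers the
    parameter; as it is continuous, it sends a connected part of [A] into one
    component of the domain of good parameters, so that components correspond
    to components. *)
Section Component.
Variables (R : realType) (p : R) (A : set 'rV[R]_3) (q : 'rV[R]_3).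
Variables (u v : 'rV[R]_3) (Pa Pb D F : {poly R}) (w : R -> R).
Variable l : 'rV[R]_3 -> R.
Let arc (s : R) := (Pa.[s] / D.[s]) *: u + (Pb.[s] / D.[s]) *: v.
Let good : set R := [set s | (D * F).[s] != 0].
Hypothesis p0 : p != 0.
Hypothesis AS : A `<=` parabolic_sphere p.
Hypothesis Aq : A q.
Hypothesis lC : continuous l.
Hypothesis uv : exists i j, wedge u v i j != 0.
Hypothesis areaF : forall s, Pa.[s] * Pb^`().[s] - Pb.[s] * Pa^`().[s] = F.[s].
Hypothesis dw : forall s, good s -> is_derive s 1 w (F.[s] / D.[s] ^+ 2).
Hypothesis arcK : forall s, good s -> A (arc s) /\ l (arc s) = s.
Hypothesis arc_onto : forall r, connected_component A q r ->
  good (l r) /\ arc (l r) = r.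

Lemma component_relative_geodesic :
  exists (I : set R) (g : R -> 'rV[R]_3),
    [/\ relative_geodesic (parabolic_sphere p) I g, regular_curve I g &
        set_bij I (connected_component A q) g].
Proof.
pose P i := u 0 i *: Pa + v 0 i *: Pb.
have arcE s : rational_arc P D s = arc s.
  by apply/rowP => i; rewrite !mxE /P hornerD !hornerZ; ring.
have wedgeP s i j : (P i).[s] * (P j)^`().[s] - (P j).[s] * (P i)^`().[s]
    = wedge u v i j * F.[s].
  by rewrite -areaF /P !derivD !derivZ !hornerD !hornerZ /wedge; ring.
have Cq : connected_component A q q by exact: connected_component_refl.
pose J := connected_component good (l q).
have Jgood : J `<=` good by exact: connected_component_sub.
have [gq arcq] := arc_onto Cq.
have Jq : J (l q) by exact: connected_component_refl.
have oJ : open J.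
  apply: open_component_real; rewrite /good.
  apply: (@open_comp _ _ (horner (D * F)) [set r | r != 0]).
    by move=> s _; exact: continuous_horner.
  exact: open_neq.
have iJ : is_interval J by apply/connected_intervalP; exact: component_connected.
have D0 s : J s -> D.[s] != 0.
  by move=> /Jgood; rewrite /good /mkset hornerM mulf_eq0 negb_or => /andP[].
have F0 s : J s -> F.[s] != 0.
  by move=> /Jgood; rewrite /good /mkset hornerM mulf_eq0 negb_or => /andP[].
have JC : rational_arc P D @` J = connected_component A q.
  apply/seteqP; split.
    apply: connected_component_max; first by exists (l q); rewrite ?arcE.
      by move=> _ [s /Jgood/arcK[? _] <-]; rewrite arcE.
    exact: rational_arc_connected.
  move=> r Cr; have [gr rE] := arc_onto Cr; exists (l r); last by rewrite arcE.
  suff : l @` connected_component A q `<=` J by apply; exists r.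
  apply: connected_component_max; first by exists q.
    by move=> _ [r' /arc_onto[? _] <-].
  apply: connected_continuous_connected; first exact: component_connected.
  exact: continuous_subspaceT.
have [||I [g [sg rg wg bg]]] := rational_arc_reparam (S := parabolic_sphere p)
    oJ iJ D0 F0 (fun s Js => dw (Jgood s Js)) wedgeP uv.
- move=> s1 s2; rewrite !inE => /Jgood/arcK[_ e1] /Jgood/arcK[_ e2] e.
  by rewrite -e1 -arcE e arcE e2.
- by move=> r; rewrite JC => /connected_component_sub/AS.
exists I, g; split => //; last by rewrite -JC.
exact/(relative_geodesic_sphere p0).
Qed.

End Component.

(** * Sections by planes through the origin *)

Section PlaneSections.
Variables (R : realType) (p : R).
Hypothesis p0 : p != 0.
Local Notation S := (parabolic_sphere p).

Lemma coord_comb_continuous (a b c : R) :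
  continuous (fun r : 'rV[R]_3 => a * r 0 0 + b * r 0 1 + c).
Proof.
move=> r; apply: differentiable_continuous.
have dc i := @differentiable_coord R 1 3 r 0 i.
apply: differentiableD; last exact: differentiable_cst.
by apply: differentiableD; apply: differentiableZ.
Qed.

Lemma plane0P (n r : 'rV[R]_3) :
  plane0 n r <-> n 0 0 * r 0 0 + n 0 1 * r 0 1 + n 0 2 * r 0 2 = 0.
Proof.
rewrite /plane0 /mkset !big_ord_recl big_ord0.
have -> : ord0 = 0 :> 'I_3 by exact/val_inj.
have -> : lift 0 0 = 1 :> 'I_3 by exact/val_inj.
have -> : lift 0 (lift 0 0) = 2 :> 'I_3 by exact/val_inj.
by rewrite addr0 addrA.
Qed.

Lemma regular_sectionP n r :
  ((S `&` plane0 n) `\` lightlike S) r <->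
  [/\ 2 * p * r 0 2 = p ^+ 2 - r 0 0 ^+ 2 + r 0 1 ^+ 2,
      n 0 0 * r 0 0 + n 0 1 * r 0 1 + n 0 2 * r 0 2 = 0 &
      r 0 0 ^+ 2 - r 0 1 ^+ 2 + p ^+ 2 != 0].
Proof.
split=> [[[Sr /plane0P nr] lr]|[/(sphereP p0) Sr /plane0P nr lr]].
  split => //; first exact/(sphereP p0).
  by apply/eqP => h; apply: lr; apply/(lightlike_sphere p0 Sr).
by split => // /(lightlike_sphere p0 Sr)/eqP; exact/negP.
Qed.

Section Isotropic.
Variables (n q : 'rV[R]_3).
Hypothesis n0 : n != 0.
Hypothesis n2 : n 0 2 = 0.
Let A := (S `&` plane0 n) `\` lightlike S.
Hypothesis Aq : A q.

(** The plane is spanned by [(n_1, - n_0, 0)] and the isotropic direction.  The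
    section is the parabola, or line, over the line with coordinate [s] along
    the first vector. *)
Lemma isotropic_section : exists (I : set R) (g : R -> 'rV[R]_3),
  [/\ relative_geodesic S I g, regular_curve I g &
      set_bij I (connected_component A q) g].
Proof.
pose N := n 0 0 ^+ 2 + n 0 1 ^+ 2.
have N0 : N != 0.
  apply: contra_neq n0 => /eqP; rewrite paddr_eq0 ?sqr_ge0 // !sqrf_eq0.
  by move=> /andP[/eqP n00 /eqP n01]; apply: rV3_eq; rewrite mxE.
pose k := (n 0 1 ^+ 2 - n 0 0 ^+ 2) / (2 * p).
pose F : {poly R} := - (k *: 'X^2) - (p / 2)%:P.
pose Pb : {poly R} := (p / 2)%:P - k *: 'X^2.
have FE s : F.[s] = - (k * s ^+ 2) - p / 2 by rewrite /F !hornerE.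
have PbE s : Pb.[s] = p / 2 - k * s ^+ 2 by rewrite /Pb !hornerE.
have goodE s : (1 * F).[s] = F.[s] by rewrite mul1r.
have light x y s : x = s * n 0 1 -> y = - (s * n 0 0) ->
    x ^+ 2 - y ^+ 2 + p ^+ 2 = - (2 * p) * F.[s].
  by move=> -> ->; rewrite FE /k; field.
apply: (@component_relative_geodesic R p A q (vec3 (n 0 1) (- n 0 0) 0)
  (vec3 0 0 1) 'X Pb 1 F (fun s => - (k / 3) * s ^+ 3 - p / 2 * s)
  (fun r => (n 0 1 / N) * r 0 0 + (- n 0 0 / N) * r 0 1 + 0)) => //.
- by move=> r [[]].
- exact: coord_comb_continuous.
- have [n00|n00] := eqVneq (n 0 0) 0.
    exists 0, 2; rewrite /wedge !vec3E mulr1 mulr0 subr0.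
    by apply: contra_neq N0 => n01; rewrite /N n00 n01 expr0n addr0.
  by exists 1, 2; rewrite /wedge !vec3E mulr1 mul0r subr0 oppr_eq0.
- move=> s; rewrite FE PbE hornerX /Pb derivX derivB derivC derivZ derivXn /=.
  rewrite !(hornerD, hornerN, hornerC, hornerZ, hornerMn, hornerX); ring.
- move=> s _; rewrite FE hornerC.
  by apply: is_derive_eq; rewrite /GRing.scale /=; field.
- move=> s; rewrite /mkset goodE => F0.
  set r := _ + _.
  have r0 : r 0 0 = s * n 0 1 by rewrite /r !mxE /= hornerX hornerC; field.
  have r1 : r 0 1 = - (s * n 0 0) by rewrite /r !mxE /= hornerX hornerC; field.
  have r2 : r 0 2 = p / 2 - k * s ^+ 2.
    by rewrite /r !mxE /= PbE hornerC; field.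
  split; last by rewrite r0 r1; move: N0; rewrite /N => ?; field.
  apply/regular_sectionP; split.
  + by rewrite r0 r1 r2 /k; field.
  + by rewrite r0 r1 n2; ring.
  + by rewrite (light _ _ _ r0 r1) mulf_neq0 // oppr_eq0 mulf_neq0 ?pnatr_eq0.
- move=> r /connected_component_sub /regular_sectionP [].
  rewrite n2 mul0r addr0 => Sr nr lr.
  set s := _ + 0.
  have r0 : r 0 0 = s * n 0 1.
    apply: (mulfI N0); rewrite /s.
    transitivity (n 0 1 * (n 0 1 * r 0 0) + n 0 0 * (n 0 0 * r 0 0)).
      by rewrite /N; ring.
    have -> : n 0 0 * r 0 0 = - (n 0 1 * r 0 1) by apply/eqP; rewrite -addr_eq0 nr.
    by field.
  have r1 : r 0 1 = - (s * n 0 0).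
    apply: (mulfI N0); rewrite /s.
    transitivity (n 0 1 * (n 0 1 * r 0 1) + n 0 0 * (n 0 0 * r 0 1)).
      by rewrite /N; ring.
    have -> : n 0 1 * r 0 1 = - (n 0 0 * r 0 0).
      by apply/eqP; rewrite -addr_eq0 addrC nr.
    by field.
  split.
    rewrite /mkset goodE; move: lr; rewrite (light _ _ _ r0 r1).
    by rewrite mulf_eq0 negb_or => /andP[].
  apply: rV3_eq; rewrite !mxE /= ?hornerX PbE hornerC ?r0 ?r1.
  + by field.
  + by field.
  + apply: (@mulfI _ (2 * p)); first by rewrite mulf_neq0 ?pnatr_eq0.
    by rewrite Sr r0 r1 /k; field.
Qed.

End Isotropic.
End PlaneSections.

(** The null coordinates are [a = x + e * y] and [b = x - e * y] with [e = 1] or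
    [e = -1]; the sign exchanges them.  The plane is [z = lam * a + mu * b], and
    [la], [lb] are the two shifted coordinates whose product is the constant [K]
    on the section. *)
Section Transversal.
Variables (R : realType) (p : R).
Hypothesis p0 : p != 0.
Local Notation S := (parabolic_sphere p).
Variables (n q : 'rV[R]_3) (e : R).
Hypothesis n2 : n 0 2 != 0.
Hypothesis ee : e * e = 1.
Let lam := - (n 0 0 + e * n 0 1) / (2 * n 0 2).
Let mu := - (n 0 0 - e * n 0 1) / (2 * n 0 2).
Let A := (S `&` plane0 n) `\` lightlike S.
Let K := p ^+ 2 + 4 * p ^+ 2 * lam * mu.
Let la (r : 'rV[R]_3) := 1 * r 0 0 + e * r 0 1 + 2 * p * mu.
Let lb (r : 'rV[R]_3) := 1 * r 0 0 + - e * r 0 1 + 2 * p * lam.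

Let sectionP r : A r <->
  [/\ r 0 2 = lam * (r 0 0 + e * r 0 1) + mu * (r 0 0 - e * r 0 1),
      la r * lb r = K &
      (r 0 0 + e * r 0 1) * (r 0 0 - e * r 0 1) + p ^+ 2 != 0].
Proof.
have sq a b : (a + e * b) * (a - e * b) = a ^+ 2 - b ^+ 2.
  by transitivity (a ^+ 2 - e * e * b ^+ 2); [ring|rewrite ee mul1r].
have planeE : n 0 0 * r 0 0 + n 0 1 * r 0 1 + n 0 2 * r 0 2 = n 0 2 *
    (r 0 2 - (lam * (r 0 0 + e * r 0 1) + mu * (r 0 0 - e * r 0 1))).
  transitivity (n 0 0 * r 0 0 + (e * e) * n 0 1 * r 0 1 + n 0 2 * r 0 2).
    by rewrite ee mul1r.
  by rewrite /lam /mu; field.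
have confE : la r * lb r - K = r 0 0 ^+ 2 - r 0 1 ^+ 2 - p ^+ 2
    + 2 * p * (lam * (r 0 0 + e * r 0 1) + mu * (r 0 0 - e * r 0 1)).
  by rewrite -sq /la /lb /K; ring.
rewrite sq; split=> [/(regular_sectionP p0) [Sr + lr]|[zE ab lr]].
  rewrite planeE => /eqP; rewrite mulf_eq0 (negbTE n2) subr_eq0 => /eqP zE.
  by split => //; apply/subr0_eq; rewrite confE -zE Sr; ring.
apply/(regular_sectionP p0); split => //; last by rewrite planeE zE subrr mulr0.
by apply/subr0_eq; move: confE; rewrite ab subrr -zE => c; rewrite [RHS]c; ring.
Qed.

(** Only the case [K = 0] needs connectedness: the section is then the union of
    the lines [la = 0] and [lb = 0], on which [la ^+ 2 - lb ^+ 2] has opposite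
    signs, and it vanishes only at the crossing point, which is lightlike. *)
Let la_neq0 r : A q -> la q != 0 -> connected_component A q r -> la r != 0.
Proof.
move=> Aq laq Cr; have Ar := connected_component_sub Cr.
have [/sectionP[_ abq _] /sectionP[_ abr _]] := (Aq, Ar).
have [K0|K0] := eqVneq K 0; last by apply: contra_neq K0 => l0; rewrite -abr l0 mul0r.
have both0 s : A s -> la s = 0 -> lb s = 0 -> False.
  move=> /sectionP[_ _ /eqP h] a0 b0; apply: h.
  have -> : s 0 0 + e * s 0 1 = - (2 * p * mu).
    by apply/subr0_eq; rewrite -a0 /la; ring.
  have -> : s 0 0 - e * s 0 1 = - (2 * p * lam).
    by apply/subr0_eq; rewrite -b0 /lb; ring.
  by rewrite -K0 /K; ring.
pose h s := la s ^+ 2 - lb s ^+ 2.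
have hC : continuous h.
  have sqC (f : 'rV[R]_3 -> R) : continuous f -> continuous (fun s => f s ^+ 2).
    by move=> fC s; exact: (continuousM (fC s) (fC s)).
  move=> s; have aC := sqC _ (@coord_comb_continuous R 1 e (2 * p * mu)) s.
  have bC := sqC _ (@coord_comb_continuous R 1 (- e) (2 * p * lam)) s.
  exact: (continuousB aC bC).
apply/eqP => lar.
have lbq : lb q = 0.
  by move/eqP: abq; rewrite K0 mulf_eq0 (negbTE laq) => /eqP.
have hq : 0 < h q by rewrite /h lbq expr0n subr0 exprn_even_gt0.
have lbr : lb r != 0 by apply/eqP; exact: both0.
have hr : h r < 0 by rewrite /h lar expr0n sub0r oppr_lt0 exprn_even_gt0.
have : is_interval (h @` connected_component A q).
  apply/connected_intervalP/connected_continuous_connected.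
    exact: component_connected.
  exact: continuous_subspaceT.
move=> ivl; have [|||s Cs hs] := ivl (h r) (h q) _ _ 0.
- by exists r.
- by exists q => //; exact: connected_component_refl.
- by rewrite !ltW.
have As := connected_component_sub Cs; have /sectionP[_ abs _] := As.
move/eqP: abs; rewrite K0 mulf_eq0 => /orP[]/eqP l0; apply: (both0 s As) => //.
  by apply/eqP; move/eqP: hs; rewrite /h l0 expr0n sub0r oppr_eq0 sqrf_eq0.
by apply/eqP; move/eqP: hs; rewrite /h l0 expr0n subr0 sqrf_eq0.
Qed.

(** With [s = la] the curve is [a = s - 2 p mu], [b = K / s - 2 p lam], of areal
    velocity [F / s ^+ 2]; a primitive involves a logarithm, taken of [s ^+ 2] so
    as to cover both signs of [s]. *)
Lemma transversal_section : A q -> la q != 0 ->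
  exists (I : set R) (g : R -> 'rV[R]_3),
  [/\ relative_geodesic S I g, regular_curve I g &
      set_bij I (connected_component A q) g].
Proof.
move=> Aq laq; have e0 : e != 0.
  by apply: contra_eq_neq ee => ->; rewrite mul0r eq_sym oner_eq0.
pose Pa : {poly R} := 'X^2 - (2 * p * mu) *: 'X.
pose Pb : {poly R} := K%:P - (2 * p * lam) *: 'X.
pose F : {poly R} := (2 * p * lam) *: 'X^2 - (2 * K) *: 'X + (2 * p * mu * K)%:P.
have PaE s : Pa.[s] = s ^+ 2 - 2 * p * mu * s by rewrite /Pa !hornerE.
have PbE s : Pb.[s] = K - 2 * p * lam * s by rewrite /Pb !hornerE.
have FE s : F.[s] = 2 * p * lam * s ^+ 2 - 2 * K * s + 2 * p * mu * K.
  by rewrite /F !hornerE.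
have goodE s : ('X * F).[s] = s * F.[s] by rewrite hornerM hornerX.
have light a b s : s != 0 -> a = s - 2 * p * mu -> b = K / s - 2 * p * lam ->
    a * b + p ^+ 2 = - (F.[s] / s).
  by move=> s0 -> ->; rewrite FE /K; field.
have AS : A `<=` S by move=> r [[]].
apply: (@component_relative_geodesic R p A q (vec3 2^-1 (e / 2) lam)
  (vec3 2^-1 (- e / 2) mu) Pa Pb 'X F
  (fun s => 2 * p * lam * s - K * ln (s ^+ 2) - 2 * p * mu * K * s^-1)
  la p0 AS Aq (@coord_comb_continuous R 1 e (2 * p * mu))).
- exists 0, 1; rewrite /wedge !vec3E.
  have -> : 2^-1 * (- e / 2) - e / 2 * 2^-1 = - (e / 2) by field.
  by rewrite oppr_eq0 mulf_neq0 // invr_eq0 pnatr_eq0.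
- move=> s; rewrite FE PaE PbE /Pa /Pb !derivB derivC !derivZ derivXn derivX /=.
  rewrite !(hornerD, hornerN, hornerC, hornerZ, hornerMn, hornerX); ring.
- move=> s; rewrite /mkset goodE mulf_eq0 negb_or => /andP[s0 _].
  rewrite FE hornerX.
  have s2 : 0 < s ^+ 2 by rewrite exprn_even_gt0.
  have dln : is_derive s 1 (fun x : R => ln (x ^+ 2)) (2 / s).
    have d1 : is_derive (s ^+ 2) 1 (@ln R) (s ^+ 2)^-1 by exact: is_derive1_ln.
    have d2 : is_derive s 1 (fun x : R => x ^+ 2) (2 * s).
      by apply: is_derive_eq; rewrite /GRing.scale /= ?expr1; ring.
    have -> : 2 / s = (s ^+ 2)^-1 * (2 * s) by field.
    exact: (@is_derive1_comp R (@ln R) (fun x => x ^+ 2) s _ _ d1 d2).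
  have dV : is_derive s 1 (fun x : R => x^-1) (- s ^- 2 *: 1).
    by apply: is_deriveV.
  by apply: is_derive_eq; rewrite /GRing.scale /=; field.
- move=> s; rewrite /mkset goodE mulf_eq0 negb_or => /andP[s0 Fs].
  set r := _ + _.
  have r0 : r 0 0 = (s - 2 * p * mu + (K / s - 2 * p * lam)) / 2.
    by rewrite /r !mxE /= PaE PbE hornerX; field.
  have r1 : r 0 1 = e * (s - 2 * p * mu - (K / s - 2 * p * lam)) / 2.
    by rewrite /r !mxE /= PaE PbE hornerX; field.
  have r2 : r 0 2 = lam * (s - 2 * p * mu) + mu * (K / s - 2 * p * lam).
    by rewrite /r !mxE /= PaE PbE hornerX; field.
  have er1 : e * r 0 1 = (s - 2 * p * mu - (K / s - 2 * p * lam)) / 2.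
    by rewrite r1 -mulrA [LHS]mulrA ee mul1r.
  have aE : r 0 0 + e * r 0 1 = s - 2 * p * mu by rewrite er1 r0; field.
  have bE : r 0 0 - e * r 0 1 = K / s - 2 * p * lam by rewrite er1 r0; field.
  have laE : la r = s by rewrite /la mul1r aE; ring.
  split => //; apply/sectionP; split; first by rewrite aE bE r2.
    by rewrite laE /lb mul1r mulNr bE; field.
  by rewrite (light _ _ _ s0 aE bE) oppr_eq0 mulf_neq0 ?invr_eq0.
- move=> r Cr; have s0 := la_neq0 Aq laq Cr.
  have /sectionP[zE ab lr] := connected_component_sub Cr.
  set s := la r in s0 ab *.
  have aE : r 0 0 + e * r 0 1 = s - 2 * p * mu by rewrite /s /la; ring.
  have bE : r 0 0 - e * r 0 1 = K / s - 2 * p * lam.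
    by rewrite -ab [s * _]mulrC mulfK // /lb; ring.
  split.
    rewrite /mkset goodE mulf_neq0 //.
    move: lr; rewrite (light _ _ _ s0 aE bE) oppr_eq0.
    by rewrite mulf_eq0 negb_or => /andP[].
  have tE : Pa.[s] / s = s - 2 * p * mu by rewrite PaE; field.
  have uE : Pb.[s] / s = K / s - 2 * p * lam by rewrite PbE; field.
  apply: rV3_eq; rewrite !mxE /= hornerX tE uE -aE -bE ?zE.
  + by field.
  + by transitivity (e * e * r 0 1); [field|rewrite ee mul1r].
  + by rewrite [X in X + _]mulrC [X in _ + X]mulrC.
Qed.

End Transversal.

(** If [la] vanished at [q] for both signs [e], then [q] would be the centre of
    the hyperbola, and lightlike. *)
Lemma section_component_geodesic (R : realType) (p : R) (n q : 'rV[R]_3) :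
  p != 0 -> n != 0 ->
  let A := (parabolic_sphere p `&` plane0 n) `\` lightlike (parabolic_sphere p) in
  A q ->
  exists (I : set R) (g : R -> 'rV[R]_3),
    [/\ relative_geodesic (parabolic_sphere p) I g, regular_curve I g &
        set_bij I (connected_component A q) g].
Proof.
move=> p0 n0 A Aq; have [n2|n2] := eqVneq (n 0 2) 0.
  exact: isotropic_section.
have [zq|] := eqVneq (1 * q 0 0 + 1 * q 0 1
    + 2 * p * (- (n 0 0 - 1 * n 0 1) / (2 * n 0 2))) 0; last first.
  by apply: (transversal_section p0 n2 (mulr1 1) Aq).
apply: (@transversal_section _ _ p0 n q (-1) n2 _ Aq); first by rewrite mulrNN mulr1.
apply/eqP => zq'.
have [Sq nq /eqP] := (regular_sectionP p0 n q).1 Aq; apply.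
have xE : q 0 0 = p * n 0 0 / n 0 2.
  by apply/subr0_eq; rewrite -[RHS](mul0r 2^-1) -[X in X / _](addr0 0) -{1}zq -zq'; field.
have yE : q 0 1 = - (p * n 0 1 / n 0 2).
  by apply/subr0_eq; rewrite -[RHS](mul0r 2^-1) -[X in X / _](subr0 0) -{1}zq -zq'; field.
have conf : q 0 0 ^+ 2 - q 0 1 ^+ 2 = - (p * q 0 2).
  apply: (mulfI n2); transitivity (p * (n 0 0 * q 0 0 + n 0 1 * q 0 1)).
    by rewrite xE yE; field.
  by rewrite (_ : _ + _ = - (n 0 2 * q 0 2)); [ring|apply/eqP; rewrite -addr_eq0 nq].
by move: Sq conf => /=; lra.
Qed.

Theorem mainTheorem11 (R : realType) (p : R) (hp : p != 0) :
  (forall (I : set R) (g : R -> 'rV[R]_3),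
     relative_geodesic (parabolic_sphere p) I g -> regular_curve I g ->
     exists2 n : 'rV[R]_3,
       n != 0 & g @` I `<=` parabolic_sphere p `&` plane0 n) /\
  (forall n : 'rV[R]_3, n != 0 ->
   forall q : 'rV[R]_3,
     let A := (parabolic_sphere p `&` plane0 n)
                `\` lightlike (parabolic_sphere p) in
     A q ->
     exists (I : set R) (g : R -> 'rV[R]_3),
       [/\ relative_geodesic (parabolic_sphere p) I g,
           regular_curve I g &
           set_bij I (connected_component A q) g]).
Proof.
split; first exact: relative_geodesic_planar.
by move=> n n0 q A Aq; exact: section_component_geodesic.
Qed.
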